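(* Let $E$ be a Banach space, $a\in\mathbb R$, and let $\Lambda$ be a well ordered subset of $[a,\infty]$ with $\min\Lambda=a$ and $\max\Lambda=\infty$ such that $[a,\infty)$ is the union of the disjoint intervals $[\alpha,S(\alpha))$, $\alpha\in\Lambda^{<\infty}$. Let $(z_\alpha)_{\alpha\in\Lambda}$ be a family in $E$ and let $g:[a,\infty]\to E$ be a step mapping satisfying $g(t)=z_\alpha$ for $t\in[\alpha,S(\alpha))$, $\alpha\in\Lambda^{<\infty}$. Then $g$ is HK integrable if and only if the family $((S(\alpha)-\alpha)z_\alpha)_{\alpha\in\Lambda^{<\infty}}$ is summable.
   Context: A subset $\Lambda$ of $\mathbb R\cup\{\infty\}$ is well ordered if each of its nonempty subsets has a smallest element. For $\beta\in\Lambda$ different from a possible maximum of $\Lambda$, $S(\beta)$ is the smallest element of $\Lambda$ greater than $\beta$ (the successor of $\beta$). $\Lambda^{<\gamma}=\{\alpha\in\Lambda:\alpha<\gamma\}$. In the claim, the $S(\alpha)$ are successors in $\Lambda$. Let $\Gamma$ be a nonempty well ordered subset of $\mathbb R\cup\{\infty\}$, $m=\min\Gamma$, $s=\sup\Gamma$. A family $(x_\alpha)_{\alpha\in\Gamma}$ in a normed space $E$ is summable if to every $\gamma\in\Gamma\cup\{s\}$ there corresponds a unique element $\sigma(\gamma)\in E$ (the sum of $(x_\alpha)_{\alpha\in\Gamma^{<\gamma}}$) such that: (i) $\sigma(m)=0$, and if $\gamma$ is the successor in $\Gamma$ of some $\beta\in\Gamma$, then $\sigma(\gamma)=\sigma(\beta)+x_\beta$;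 (ii) if $\gamma>m$ is not a successor, then for each $\epsilon>0$ there is $\beta_\epsilon\in\Gamma^{<\gamma}$ such that $\|\sigma(\beta)-\sigma(\gamma)\|<\epsilon$ whenever $\beta\in\Gamma$ and $\beta_\epsilon\le\beta<\gamma$. A mapping $g:[a,c]\to E$ ($-\infty<a<c<\infty$) is HK (Henstock–Kurzweil) integrable if there is $f:[a,c]\to E$ such that for each $\epsilon>0$ there is $\delta:[a,c]\to(0,\infty)$ such that whenever $a=t_0<\dots<t_m=c$ and $\xi_i\in[t_{i-1},t_i]\subset(\xi_i-\delta(\xi_i),\xi_i+\delta(\xi_i))$ for all $i$, then $\left\|\sum_{i=1}^m(f(t_i)-f(t_{i-1})-g(\xi_i)(t_i-t_{i-1}))\right\|<\epsilon$; then $\int_a^cg(s)\,ds:=f(c)-f(a)$. A mapping $g:[a,\infty]\to E$ is HK integrable (on $[a,\infty]$) if and only if it is HK integrable on $[a,c]$ for each $c\in(a,\infty)$ and $\lim_{c\to\infty}\int_a^cg(s)\,ds$ exists in $E$. *)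

(* Defs.v *)
From HB Require Import structures.
From mathcomp Require Import all_boot all_order all_algebra.
From mathcomp Require Import all_classical all_reals all_analysis.
Set Implicit Arguments.
Unset Strict Implicit.
Unset Printing Implicit Defensive.
Import Order.TTheory GRing.Theory Num.Theory.
Import numFieldNormedType.Exports.
Local Open Scope classical_set_scope.
Local Open Scope ring_scope.

Definition is_min (R : realType) (A : set (\bar R)) (x : \bar R) : Prop :=
  A x /\ lbound A x.

(* The subsets live in `R U {+oo}`, hence the exclusion of -oo. *)
Definition well_ordered (R : realType) (A : set (\bar R)) : Prop :=
  ~ A -oo%E /\
  forall B : set (\bar R), B `<=` A -> B !=set0 -> exists x, is_min B x.

Definition is_succ (R : realType) (A : set (\bar R)) (b c : \bar R) : Prop :=
  is_min [set y | A y /\ (b < y)%E] c.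

(* The value +oo is junk when b has no successor in A. *)
Definition succ (R : realType) (A : set (\bar R)) (b : \bar R) : \bar R :=
  xget +oo%E [set c | is_succ A b c].

Definition below (R : realType) (A : set (\bar R)) (c : \bar R) :
    set (\bar R) := [set x | A x /\ (x < c)%E].

Definition partial_sums (R : realType) (E : normedModType R)
    (G : set (\bar R)) (x sigma : \bar R -> E) : Prop :=
  [/\ forall m, is_min G m -> sigma m = 0,
      forall b c, G b -> is_succ G b c -> sigma c = sigma b + x b &
      forall m c, is_min G m -> (G `|` [set ereal_sup G]) c -> (m < c)%E ->
        ~ (exists2 b, G b & is_succ G b c) ->
        forall e : R, 0 < e -> exists2 b0, below G c b0 &
          forall b, G b -> (b0 <= b)%E -> (b < c)%E ->
            `|sigma b - sigma c| < e].

(* Summability of the family (x b), b in G, for a nonempty well ordered G;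
   uniqueness of sigma is only meaningful on `G U {sup G}`. *)
Definition wo_summable (R : realType) (E : normedModType R)
    (G : set (\bar R)) (x : \bar R -> E) : Prop :=
  exists2 sigma : \bar R -> E, partial_sums G x sigma &
    forall sigma', partial_sums G x sigma' ->
      {in G `|` [set ereal_sup G], sigma' =1 sigma}.

(* `v` scaled by the length `r` exists and equals `w`.  An infinite length is
   allowed only for v = 0, with the convention oo * 0 = 0. *)
Definition is_scaled (R : realType) (E : normedModType R)
    (r : \bar R) (v w : E) : Prop :=
  match r with
  | r%:E => w = r *: v
  | _ => v = 0 /\ w = 0
  end.

(* t lists the n.+1 division points and xi the n tags; their values at larger
   indices are irrelevant. *)
Definition fine_partition (R : realType) (a c : R) (delta : R -> R)
    (n : nat) (t xi : nat -> R) : Prop :=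
  [/\ t 0%N = a, t n = c &
      forall i, (i < n)%N ->
        [/\ t i < t i.+1, xi i \in `[t i, t i.+1] &
            `[t i, t i.+1] `<=`
              `]xi i - delta (xi i), xi i + delta (xi i)[ ] ].

Definition HK_primitive (R : realType) (E : normedModType R) (a c : R)
    (g f : R -> E) : Prop :=
  forall e : R, 0 < e ->
    exists2 delta : R -> R, (forall s, s \in `[a, c] -> 0 < delta s) &
      forall (n : nat) (t xi : nat -> R), fine_partition a c delta n t xi ->
        `| \sum_(i < n) (f (t i.+1) - f (t i)
             - (t i.+1 - t i) *: g (xi i)) | < e.

Definition HK_integrable (R : realType) (E : normedModType R) (a c : R)
    (g : R -> E) : Prop := exists f, HK_primitive a c g f.

(* Well defined because f c - f a does not depend on the choice of f. *)
Definition HK_integral (R : realType) (E : normedModType R) (a c : R)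
    (g : R -> E) : E :=
  xget 0 [set I | exists2 f, HK_primitive a c g f & I = f c - f a].

Definition HK_integrable_infty (R : realType) (E : normedModType R) (a : R)
    (g : \bar R -> E) : Prop :=
  (forall c, a < c -> HK_integrable a c (g \o EFin)) /\
  exists l : E, HK_integral a c (g \o EFin) @[c --> +oo] --> l.

(* Main.v *)
Require Import Defs.
From HB Require Import structures.
From mathcomp Require Import all_boot all_order all_algebra.
From mathcomp Require Import all_classical all_reals all_analysis.
From mathcomp Require Import lra.
Import Order.TTheory GRing.Theory Num.Theory.
Import numFieldNormedType.Exports.
Local Open Scope classical_set_scope.
Local Open Scope ring_scope.
Set Implicit Arguments.
Unset Strict Implicit.
Unset Printing Implicit Defensive.

(** The family is summed by the integral function: the partial sum of
    [(S(b) - b) z_b] below [c] is the integral of [g] from [a] to [c].  All the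
    work is in matching the two descriptions at the limit elements of [L],
    those different from [a] that are not successors.

    From integrals to sums, put [F c] for the integral of [g] over [a, c].  On
    a block [b, S b) the map [g] is constant, so
    [F (S b) = F b + (S b - b) z_b] ([HK_integral_const_tail]); at a finite
    limit element the sums converge because [F] is left continuous
    ([HK_integral_left_continuous]), and at infinity because [F] is assumed to
    converge.  If some block is unbounded, convergence of [F] forces its value
    to be zero.  Both facts about [F] come from extending a fine partition of
    a shorter interval.  Sums are unique by a minimal counterexample argument
    ([partial_sums_unique]).

    From sums to integrals, interpolate the sums [sigma] linearly on each
    block.  The resulting [f] ([step_primitive]) is left continuous, because at
    a limit element [c] the values of [f] near [c] are convex combinations of
    consecutive sums near [sigma c].  It has increments [(v - u) z_b]
    inside each block, so the only errors in its Riemann sums come from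
    subintervals whose tag is a left end point [s] of a block and which begin
    before [s].  Left continuity makes such an error at most a small multiple
    of the length of the block, and each block is charged at most once.  This
    is a telescoping estimate: the nondecreasing function sending [t] to the
    right end of its block, truncated at [c + 1], grows by at least that
    (truncated) length across such a subinterval.  So [f] satisfies the
    criterion [HK_primitive_major] with a small multiple of this function. *)

(** * Fine partitions and the integral *)

(** Induction along a compact interval, the form in which Cousin's lemma is
    used: a property that can be carried across every small interval around a
    tag [s] propagates from [a] to [c].  The supremum of the points reached so
    far is itself a possible tag, and one step from it either passes it or
    reaches [c]. *)
Lemma cousin_ind (R : realType) (P : R -> Prop) (a c : R) : a <= c -> P a ->
    (forall s, a <= s <= c -> exists2 d, 0 < d &
      forall u v, a <= u -> v <= c -> u <= s <= v -> u < v ->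
        s - d < u -> v < s + d -> P u -> P v) ->
  P c.
Proof.
move=> ac Pa Pstep.
pose A := [set x | a <= x <= c /\ P x].
have Aa : A a by split=> //; rewrite lexx.
have Aub : ubound A c by move=> x [/andP[]].
have supA : has_sup A by split; [exists a | exists c].
have a_s : a <= sup A by apply: ub_le_sup => //; exists c.
have s_c : sup A <= c by apply: ge_sup => //; exists a.
have [|d d0 step] := Pstep (sup A); first by rewrite a_s.
have [x Ax sx] := sup_adherent d0 supA.
have xs : x <= sup A by apply: ub_le_sup => //; exists c.
have [/andP[ax xc] Px] := Ax.
pose y := Num.min (sup A + d / 2) c.
have yc : y <= c by rewrite /y ge_min lexx orbT.
have yc' : y <= sup A -> y = c.
  rewrite /y; case: (leP (sup A + d / 2) c) => //; lra.
have sy : sup A <= y by rewrite /y le_min s_c andbT; lra.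
have ysd : y < sup A + d by rewrite /y gt_min; apply/orP; left; lra.
have [yx|xy] := leP y x.
  by have <- : x = c by apply/le_anti; rewrite xc -(yc' (le_trans yx xs)).
have Py : P y by apply: (step x) => //; rewrite xs.
rewrite -(yc' _) //; apply: ub_le_sup; first by exists c.
by split=> //; rewrite yc andbT (le_trans ax)// ltW.
Qed.

Section HKIntegral.
Context (R : realType) (E : normedModType R).
Implicit Types (a b c : R) (delta : R -> R) (n : nat) (t xi : nat -> R).
Implicit Types (g f : R -> E) (I : E).

Definition riemann_sum g n t xi : E :=
  \sum_(i < n) (t i.+1 - t i) *: g (xi i).

(** The differences of [f] telescope in the definition of [HK_primitive], so
    only [f c - f a] matters there; this is the definition in terms of that
    value. *)
Definition has_HK_integral a c g I : Prop :=
  forall e : R, 0 < e ->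
    exists2 delta : R -> R, (forall s, s \in `[a, c] -> 0 < delta s) &
      forall n t xi, fine_partition a c delta n t xi ->
        `|I - riemann_sum g n t xi| < e.

Lemma fine_partition_mono a c delta n t xi i j :
  fine_partition a c delta n t xi -> (i <= j <= n)%N -> t i <= t j.
Proof.
move=> [_ _ tP]; elim: j => [|j IH /andP[]].
  by case: i.
rewrite leq_eqVlt => /predU1P[->//|ij jn].
have [+ _ _] := tP j jn; move=> /ltW; apply: le_trans.
by apply: IH; rewrite -ltnS ij ltnW.
Qed.

Lemma fine_partition_mem a c delta n t xi i :
  fine_partition a c delta n t xi -> (i <= n)%N -> a <= t i <= c.
Proof.
move=> tP ni; have [<- <- _] := tP.
by rewrite !(fine_partition_mono tP)// ?ni ?leqnn.
Qed.

Lemma fine_partition_le a c delta delta' n t xi :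
  (forall s, delta s <= delta' s) ->
  fine_partition a c delta n t xi -> fine_partition a c delta' n t xi.
Proof.
move=> dd' [t0 tn tP]; split=> // i /tP[? ? sub]; split=> //.
move=> x /sub /=; rewrite !in_itv/= => /andP[lx xu].
by have le_dd' := dd' (xi i); apply/andP; split; lra.
Qed.

(** Extending a partition by one tagged interval is the only operation on
    partitions that the proof needs.  The same new partition serves every
    integrand. *)
Lemma fine_partition_rcons a b c delta n t xi s :
    fine_partition a b delta n t xi -> b < c -> b <= s <= c ->
    s - delta s < b -> c < s + delta s ->
  exists t' xi', fine_partition a c delta n.+1 t' xi' /\
    forall g, riemann_sum g n.+1 t' xi' = riemann_sum g n t xi + (c - b) *: g s.
Proof.
move=> [t0 tn tP] bc /andP[bs sc] sb cs.
exists (fun i => if (i <= n)%N then t i else c).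
exists (fun i => if (i < n)%N then xi i else s); split.
  split=> [||i]; rewrite ?leq0n ?ltnn//.
  rewrite ltnS leq_eqVlt => /predU1P[->|i_n]; last first.
    by rewrite i_n orbT; exact: tP.
  rewrite eqxx !ltnn tn; split=> //; first by rewrite in_itv/= bs sc.
  by move=> x /=; rewrite !in_itv/= => /andP[bx xc]; apply/andP; split; lra.
move=> g; rewrite /riemann_sum big_ord_recr/= leqnn !ltnn tn; congr (_ + _).
by apply: eq_bigr => i _; rewrite (ltn_ord i) (ltnW (ltn_ord i)).
Qed.

Lemma fine_partition_nil a delta t xi :
  t 0%N = a -> fine_partition a a delta 0 t xi.
Proof. by []. Qed.

Lemma cousin a c delta : a <= c -> (forall s, s \in `[a, c] -> 0 < delta s) ->
  exists n t xi, fine_partition a c delta n t xi.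
Proof.
move=> ac d0.
pose P x := exists n t xi, fine_partition a x delta n t xi.
apply: (@cousin_ind _ P a c) => //.
  by exists 0%N, (fun=> a), (fun=> a); exact: fine_partition_nil.
move=> s sac; exists (delta s); first by apply: d0; rewrite in_itv.
move=> u v _ _ suv uv su vs [n [t [xi tP]]].
have [t' [xi' [t'P _]]] := fine_partition_rcons tP uv suv su vs.
by exists n.+1, t', xi'.
Qed.

Lemma HK_primitive_integral a c g f :
  HK_primitive a c g f -> has_HK_integral a c g (f c - f a).
Proof.
move=> fP e /fP[delta d0 dP]; exists delta => // n t xi tP.
have [t0 tn _] := tP; have := dP _ _ _ tP.
by rewrite sumrB -(big_mkord xpredT (fun i => f (t i.+1) - f (t i)))
  (telescope_sumr (f \o t))//= tn t0.
Qed.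

(** A gauge fixed beforehand on the larger interval [a, c] can be combined with
    the one that computes the integral over [a, b]; the partition found is then
    extended to one of [a, c] that is still fine for the first gauge. *)
Lemma has_HK_integral_fine a b c delta g I : a <= b -> b <= c ->
    (forall s, s \in `[a, c] -> 0 < delta s) -> has_HK_integral a b g I ->
  forall e, 0 < e -> exists n t xi, fine_partition a b delta n t xi /\
    `|I - riemann_sum g n t xi| < e.
Proof.
move=> ab bc d0 gI e e0; have [d' d'0 d'P] := gI e e0.
pose D s := Num.min (delta s) (d' s).
have [|n [t [xi tP]]] := @cousin a b D ab.
  move=> s sab; rewrite lt_min d'0//= d0//.
  by move: sab; rewrite !in_itv/= => /andP[->/=]/le_trans; apply.
exists n, t, xi; split.
  by apply: fine_partition_le tP => s; rewrite ge_min lexx.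
by apply: d'P; apply: fine_partition_le tP => s; rewrite ge_min lexx orbT.
Qed.

Lemma normr_lt_eq0 (v : E) : (forall e, 0 < e -> `|v| < e) -> v = 0.
Proof.
move=> v0; apply/eqP; rewrite -normr_eq0; apply/negPn/negP => vn0.
by have := v0 `|v|; rewrite ltxx lt_neqAle eq_sym vn0 normr_ge0 => /(_ isT).
Qed.

Lemma has_HK_integral_unique a c g I J : a <= c ->
  has_HK_integral a c g I -> has_HK_integral a c g J -> I = J.
Proof.
move=> ac gI gJ; apply/subr0_eq/normr_lt_eq0 => e e0.
have e20 : 0 < e / 2 by lra.
have [d d0 dJ] := gJ _ e20.
have [n [t [xi [tP It]]]] := has_HK_integral_fine ac (lexx c) d0 gI e20.
have Jt := dJ _ _ _ tP.
rewrite -(subrKA (riemann_sum g n t xi)) (le_lt_trans (ler_normD _ _))//.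
by rewrite (distrC _ J); lra.
Qed.

Lemma has_HK_integralE a c g I : a <= c ->
  has_HK_integral a c g I -> HK_integrable a c g -> HK_integral a c g = I.
Proof.
move=> ac gI [f fP]; rewrite /HK_integral; case: xgetP => [J _ [f' f'P ->]|].
  by apply: (has_HK_integral_unique ac) gI; exact: HK_primitive_integral.
by move=> /(_ (f c - f a)); case; exists f.
Qed.

Lemma HK_integralP a c g :
  HK_integrable a c g -> has_HK_integral a c g (HK_integral a c g).
Proof.
move=> [f fP]; rewrite /HK_integral; case: xgetP => [J _ [f' f'P ->]|].
  exact: HK_primitive_integral.
by move=> /(_ (f c - f a)); case; exists f.
Qed.

Lemma HK_integral_primitive a c g f : a <= c ->
  HK_primitive a c g f -> HK_integral a c g = f c - f a.
Proof.
move=> ac fP; apply: has_HK_integralE => //; last by exists f.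
exact: HK_primitive_integral.
Qed.

Lemma HK_primitive_point a g f : HK_primitive a a g f.
Proof.
move=> e e0; exists (fun=> 1) => // -[|n] t xi tP.
  by rewrite big_ord0 normr0.
have [t0 tn /(_ _ (ltn0Sn _))[lt_t _ _]] := tP.
have := fine_partition_mem tP (isT : (1 <= n.+1)%N); lra.
Qed.

Lemma HK_integrable_point a g : HK_integrable a a g.
Proof. by exists (fun=> 0); exact: HK_primitive_point. Qed.

Lemma HK_integral_point a g : HK_integral a a g = 0.
Proof.
by rewrite (@HK_integral_primitive _ _ _ (fun=> 0)) ?subrr//;
  exact: HK_primitive_point.
Qed.

(** Close enough to [c], the interval [b, c] with tag [c] may be appended to any
    fine partition of [a, b], and it adds only [(c - b) *: g c]. *)
Lemma HK_integral_left_continuous a c g : a < c ->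
    (forall b, a <= b <= c -> HK_integrable a b g) ->
  forall e, 0 < e -> exists2 d, 0 < d & forall b, a <= b < c -> c - d < b ->
    `|HK_integral a b g - HK_integral a c g| < e.
Proof.
move=> ac gint e e0; have e30 : 0 < e / 3 by lra.
have gc : HK_integrable a c g by apply: gint; rewrite ltW//=.
have [D D0 DP] := HK_integralP gc e30.
have Dc : 0 < D c by apply: D0; rewrite in_itv/= lexx ltW.
pose k := `|g c| + 1; have k0 : 0 < k by rewrite ltr_pwDr.
exists (Num.min (D c) (e / 3 / k)); first by rewrite lt_min Dc divr_gt0.
move=> b /andP[ab bc]; rewrite ltrBlDr -ltrBlDl lt_min => /andP[cbD cbe].
have gb : HK_integrable a b g by apply: gint; rewrite ab ltW.
have [n [t [xi [tP bP]]]] :=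
  has_HK_integral_fine ab (ltW bc) D0 (HK_integralP gb) e30.
have [|||t' [xi' [t'P sumE]]] := fine_partition_rcons (s := c) tP bc.
- by rewrite lexx ltW.
- lra.
- lra.
have := DP _ _ _ t'P; rewrite sumE => cP.
have gcb : `|(c - b) *: g c| < e / 3.
  rewrite normrZ gtr0_norm ?subr_gt0//.
  rewrite ltr_pdivlMr// in cbe; apply: le_lt_trans cbe.
  by rewrite ler_pM2l ?subr_gt0// /k lerDl.
move: bP cP; set S := riemann_sum _ _ _ _; set F := HK_integral a b g.
set F' := HK_integral a c g => bP cP.
have -> : F - F' = (F - S) - (F' - (S + (c - b) *: g c)) - (c - b) *: g c.
  by rewrite opprB !addrA subrK addrAC addrK.
rewrite (le_lt_trans (ler_normB _ _))//.
have := ler_normB (F - S) (F' - (S + (c - b) *: g c)); lra.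
Qed.

(** A fine partition of [a, b] is continued to [c] by [cousin_ind]; the
    intervals added contribute exactly [v] times their length, except the last
    one, whose tag may be [c], where [g] is arbitrary. *)
Lemma HK_integral_const_tail a b c g (v : E) : a <= b -> b <= c ->
    HK_integrable a b g -> HK_integrable a c g ->
    (forall s, b <= s < c -> g s = v) ->
  HK_integral a c g = HK_integral a b g + (c - b) *: v.
Proof.
move=> ab bc gb gc gv; apply/subr0_eq/normr_lt_eq0 => e e0.
have e40 : 0 < e / 4 by lra.
have [D D0 DP] := HK_integralP gc e40.
have [n [t [xi [tP bP]]]] :=
  has_HK_integral_fine ab bc D0 (HK_integralP gb) e40.
pose F := HK_integral a b g.
(* The bound doubles at c to pay for the single interval tagged at c. *)
pose P x := exists n t xi, fine_partition a x D n t xi /\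
  `|F + (x - b) *: v - riemann_sum g n t xi| < (if x < c then e / 4 else e / 2).
have [||s /andP[bs sc]|n1 [t1 [xi1 [t1P]]]] := @cousin_ind _ P b c.
- exact: bc.
- exists n, t, xi; split=> //; rewrite subrr scale0r addr0; case: ifP; lra.
- have Ds : 0 < D s by apply: D0; rewrite in_itv/= sc (le_trans ab).
  pose k := `|v - g s| + 1; have k0 : 0 < k by rewrite ltr_pwDr.
  exists (Num.min (D s) (e / 4 / k)); first by rewrite lt_min Ds divr_gt0.
  move=> p q _ qc psq pq; rewrite ltrBlDr -ltrBlDl -ltrBlDl !lt_min.
  move=> /andP[spD spe] /andP[qsD qse] [n2 [t2 [xi2 [t2P]]]].
  rewrite (lt_le_trans pq qc).
  have [||t' [xi' [t'P sumE]]] := fine_partition_rcons t2P pq psq; [lra|lra|].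
  move=> pP; exists n2.+1, t', xi'; split=> //; rewrite sumE.
  set S := riemann_sum _ _ _ _ in pP *.
  have -> : F + (q - b) *: v - (S + (q - p) *: g s) =
            F + (p - b) *: v - S + (q - p) *: (v - g s).
    have -> : q - b = (p - b) + (q - p) by lra.
    rewrite scalerDl scalerBr opprD !addrA; congr (_ - _).
    by rewrite -!addrA; congr (_ + (_ + _)); rewrite addrC.
  have [sltc|cs] := ltP s c.
    by rewrite gv ?bs// subrr scaler0 addr0; case: ifP => //; lra.
  have sE : s = c by apply/le_anti; rewrite sc.
  have qE : q = c by apply/le_anti; rewrite qc -sE; case/andP: psq.
  rewrite qE ltxx; rewrite (le_lt_trans (ler_normD _ _))//.
  suff : `|(c - p) *: (v - g s)| < e / 4 by lra.
  rewrite normrZ -qE gtr0_norm ?subr_gt0//.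
  rewrite sE -qE ltr_pdivlMr// in spe; apply: le_lt_trans spe.
  by rewrite ler_pM2l ?subr_gt0// /k lerDl.
rewrite ltxx => cP.
move: (DP _ _ _ t1P) cP; set S := riemann_sum _ _ _ _ => SP cP.
rewrite -(subrKA S) (le_lt_trans (ler_normD _ _))//.
by rewrite (distrC S); lra.
Qed.

(** A criterion of Ward type: if the local errors of [f] are bounded by the
    increments of a function [phi], then the error of a whole partition is
    bounded by [phi c - phi a], because these increments telescope. *)
Lemma HK_primitive_major a c g f :
    (forall e : R, 0 < e -> exists phi : R -> R, phi c - phi a < e /\
      forall s, a <= s <= c -> exists2 d, 0 < d &
        forall u v, a <= u -> v <= c -> u <= s <= v -> s - d < u -> v < s + d ->
          `|f v - f u - (v - u) *: g s| <= phi v - phi u) ->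
  HK_primitive a c g f.
Proof.
move=> fmaj e /fmaj[phi [phie phiP]].
have /choice[D DP] : forall s, exists d, a <= s <= c -> 0 < d /\
    forall u v, a <= u -> v <= c -> u <= s <= v -> s - d < u -> v < s + d ->
      `|f v - f u - (v - u) *: g s| <= phi v - phi u.
  move=> s; have [sac|nsac] := boolP (a <= s <= c); last by exists 0.
  by have [d d0 dP] := phiP s sac; exists d.
exists D => [s|n t xi tP]; first by rewrite in_itv/= => /DP[].
have [t0 tn step] := tP.
rewrite (le_lt_trans (ler_norm_sum _ _ _))//.
apply: le_lt_trans phie; rewrite -[in leRHS]tn -[in leRHS]t0.
rewrite -(telescope_sumr (phi \o t))// big_mkord; apply: ler_sum => i _.
have [tt xiP sub] := step i (ltn_ord i).
have /andP[a_t _] := fine_partition_mem tP (ltnW (ltn_ord i)).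
have /andP[_ t_c] := fine_partition_mem tP (ltn_ord i).
rewrite in_itv/= in xiP; have /andP[tx xt] := xiP.
have [|_ /=] := DP (xi i); first by rewrite (le_trans a_t)//= (le_trans xt).
have /= := sub (t i); rewrite !in_itv/= lexx (ltW tt) => /(_ isT)/andP[+ _].
have /= := sub (t i.+1); rewrite !in_itv/= lexx (ltW tt) => /(_ isT)/andP[_ +].
by move=> vx ux; apply.
Qed.

End HKIntegral.

(** * Blocks and limit elements *)

Section Blocks.
Context (R : realType) (a : R) (L : set (\bar R)).
Hypothesis L_wo : well_ordered L.
Hypothesis L_min : is_min L a%:E.
Hypothesis L_max : L +oo%E.
Hypothesis L_cover : [set t : R | a <= t] =
  \bigcup_(b in below L +oo%E) [set t : R | (b <= t%:E < succ L b)%E].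

Let G := below L +oo%E.
Let S := succ L.

Lemma below_fine b : G b -> exists2 r : R, b = r%:E & a <= r.
Proof.
move=> [Lb boo]; have := L_min.2 _ Lb.
by case: b boo Lb => // r _ _; rewrite lee_fin => ar; exists r.
Qed.

Lemma below_min : G a%:E.
Proof. by split; [case: L_min|rewrite ltry]. Qed.

Lemma succP b : G b -> [/\ L (S b), (b < S b)%E &
  forall y, L y -> (b < y)%E -> (S b <= y)%E].
Proof.
move=> [Lb boo].
have [|c cP] := L_wo.2 [set y | L y /\ (b < y)%E] (fun y => @proj1 _ _).
  by exists +oo%E.
have [[LS bS] Smin] : is_succ L b (S b).
  by rewrite /S /succ; case: xgetP => [y _ //|/(_ c)].
by split=> // y Ly lt_by; apply: Smin.
Qed.

Lemma is_succ_belowP b c : G b -> is_succ G b c <-> G c /\ S b = c.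
Proof.
move=> Gb; have [LS bS Smin] := succP Gb; split=> [[[Gc bc] cmin]|[+ SE]].
  have Sc := Smin _ Gc.1 bc; split=> //; apply/le_anti; rewrite Sc/=.
  by apply: cmin; split=> //; split=> //; exact: le_lt_trans Sc Gc.2.
by rewrite -SE => GS; split=> [|y [[Ly _] lt_by]]; [split|exact: Smin].
Qed.

(** Since [L] contains infinity, this covers the supremum of [below L +oo] too,
    when that set has no maximum. *)
Definition limit_element (c : \bar R) : Prop :=
  [/\ L c, (a%:E < c)%E & forall b, G b -> S b <> c].

Lemma successor_or_limit c : L c -> (a%:E < c)%E ->
  (exists2 b, G b & S b = c) \/ limit_element c.
Proof.
move=> Lc ac; have [?|nS] := pselect (exists2 b, G b & S b = c); first by left.
by right; split=> // b Gb Sb; apply: nS; exists b.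
Qed.

Lemma exists_block t : a <= t -> exists r : R,
  [/\ G r%:E, r <= t & (t%:E < S r%:E)%E].
Proof.
move=> a_t; have : [set t : R | a <= t] t by [].
rewrite L_cover => -[b Gb /= /andP[]]; have [r bE _] := below_fine Gb.
by rewrite bE in Gb *; rewrite lee_fin => rt tS; exists r.
Qed.

Definition left_end (t : R) : R :=
  xget a [set r : R | [/\ G r%:E, r <= t & (t%:E < S r%:E)%E]].

Lemma left_endP t : a <= t ->
  [/\ G (left_end t)%:E, left_end t <= t & (t%:E < S (left_end t)%:E)%E].
Proof.
move=> /exists_block[r rP]; rewrite /left_end.
by case: xgetP => [//|/(_ r)].
Qed.

Lemma succ_le_left b c : G b -> L c -> (b < c)%E -> (S b <= c)%E.
Proof. by move=> Gb Lc bc; have [_ _] := succP Gb; apply. Qed.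

Lemma left_end_eq r t : G r%:E -> r <= t -> (t%:E < S r%:E)%E -> left_end t = r.
Proof.
move=> Gr rt tS; have [_ [<-] ar] := below_fine Gr.
have [Gl lt_ tSl] := left_endP (le_trans ar rt).
apply/le_anti; rewrite !leNgt; apply/andP; split; apply/negP => lr.
  have := lt_le_trans tS (succ_le_left Gr Gl.1 _); rewrite lte_fin => /(_ lr).
  by rewrite lte_fin ltNge lt_.
have := lt_le_trans tSl (succ_le_left Gl Gr.1 _); rewrite lte_fin => /(_ lr).
by rewrite lte_fin ltNge rt.
Qed.

(** The block of [t] lies below [c], and its right end is not [c]; that end is
    the element sought.  This is where the covering hypothesis makes limit
    elements topological limits. *)
Lemma limit_approach c t : limit_element c -> a <= t -> (t%:E < c)%E ->
  exists2 b : R, G b%:E & t < b /\ (b%:E < c)%E.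
Proof.
move=> [Lc _ nS] a_t tc; have [Gl lt_ tS] := left_endP a_t.
have Slc : (S (left_end t)%:E < c)%E.
  rewrite lt_neqAle; apply/andP; split; first exact/eqP/nS.
  by apply: succ_le_left => //; apply: le_lt_trans tc; rewrite lee_fin.
have [LS _ _] := succP Gl.
have GS : G (S (left_end t)%:E) by split=> //; apply: lt_le_trans Slc (leey _).
have [r SE _] := below_fine GS; rewrite SE in GS tS Slc.
by exists r.
Qed.

(** An unbounded block starts at the maximum of [below L +oo], so the supremum
    is then finite and nothing is required of the sums at infinity. *)
Lemma last_block b : G b -> S b = +oo%E -> ereal_sup G = b.
Proof.
move=> Gb Sb; apply/le_anti/andP; split; last exact: ereal_sup_ubound.
apply: ge_ereal_sup => y [Ly yoo]; rewrite leNgt; apply/negP => lt_by.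
by have := succ_le_left Gb Ly lt_by; rewrite Sb leye_eq => /eqP yE;
  rewrite yE in yoo.
Qed.

Lemma ereal_sup_limit : limit_element +oo%E -> ereal_sup G = +oo%E.
Proof.
move=> ooP; have ubG := @ereal_sup_ubound R G; have := ubG _ below_min.
case sE : (ereal_sup G) => [t| |//]; rewrite ?leeNy_eq// lee_fin => a_t.
have [b Gb [tb _]] := limit_approach ooP a_t (ltry t).
by have := ubG _ Gb; rewrite sE lee_fin leNgt tb.
Qed.

Lemma ereal_sup_below_in : L (ereal_sup G).
Proof.
have [[b Gb Sb]|ooP] := successor_or_limit L_max (ltry a).
  by rewrite (last_block Gb Sb); case: Gb.
by rewrite ereal_sup_limit.
Qed.

(** The only successor in [L] that can fail to be finite is that of the maximum,
    and then the supremum is this maximum and not infinity. *)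
Lemma below_succ b : G b -> (G `|` [set ereal_sup G]) (S b) -> G (S b).
Proof.
move=> Gb [//|/= SE]; have [LS bS _] := succP Gb; split=> //.
rewrite ltey; apply/eqP => Soo; have := last_block Gb Soo.
by rewrite -SE Soo => bE; rewrite -bE in Gb; case: Gb.
Qed.

(** * Partial sums *)

Section Family.
Context (E : normedModType R).
Implicit Types (x sigma : \bar R -> E).

(** [partial_sums] takes successors within [below L +oo] and treats the
    supremum apart; the hypotheses on [L] allow both to be read in [L]. *)
Lemma partial_sumsP x sigma : partial_sums G x sigma <->
  [/\ sigma a%:E = 0,
      forall b, G b -> G (S b) -> sigma (S b) = sigma b + x b &
      forall c, limit_element c -> forall e : R, 0 < e ->
        exists2 b0 : R, G b0%:E /\ (b0%:E < c)%E &
          forall b, G b -> (b0%:E <= b)%E -> (b < c)%E ->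
            `|sigma b - sigma c| < e].
Proof.
have minG : is_min G a%:E by split; [exact: below_min|move=> y [/(L_min.2)]].
have minE m : is_min G m -> m = a%:E.
  move=> [Gm mmin]; apply/le_anti; rewrite (mmin _ below_min)/=.
  exact: (minG.2 _ Gm).
split=> [[s0 sS sl]|[s0 sS sl]].
  split=> [|b Gb GS|c cP e e0]; first exact: s0.
    by apply: sS => //; apply/is_succ_belowP.
  have [Lc ac nS] := cP.
  have Gc : (G `|` [set ereal_sup G]) c.
    have [coo|] := eqVneq c +oo%E; last by rewrite -ltey; left.
    by right; rewrite /= coo ereal_sup_limit// -coo.
  have [|b0 [Gb0 bc] b0P] := sl _ _ minG Gc ac _ _ e0.
    by move=> [b Gb /(is_succ_belowP _ Gb)[_]]; exact: nS.
  have [r b0E _] := below_fine Gb0; rewrite b0E in Gb0 bc b0P.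
  by exists r.
split=> [m /minE->//|b c Gb /(is_succ_belowP _ Gb)[Gc SE]|].
  by rewrite -SE in Gc *; exact: sS.
move=> m c /minE-> Gc ac nS e e0.
have cP : limit_element c.
  have Lc : L c by case: Gc => [[]//|->]; exact: ereal_sup_below_in.
  split=> // b Gb Sb; apply: nS; exists b => //.
  apply/is_succ_belowP => //; split=> //.
  by rewrite -Sb; apply: below_succ; rewrite ?Sb.
by have [b0 Gb0 b0P] := sl c cP e e0; exists b0%:E.
Qed.

(** At the least element where two systems of sums differ, each of the three
    clauses determines the value from earlier ones. *)
Lemma partial_sums_unique x sigma sigma' :
  partial_sums G x sigma -> partial_sums G x sigma' ->
  {in G `|` [set ereal_sup G], sigma' =1 sigma}.
Proof.
move=> /partial_sumsP[s0 sS sl] /partial_sumsP[s0' sS' sl'] c0.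
rewrite inE => Gc0.
apply: contrapT => c0P.
pose D := [set c | (G `|` [set ereal_sup G]) c /\ sigma' c <> sigma c].
have DL : D `<=` L by move=> y [[[]//|->] _]; exact: ereal_sup_below_in.
have [|c [[Gc ncE] cmin]] := L_wo.2 D DL; first by exists c0.
have Lc : L c by apply: DL.
have ltcE y : G y -> (y < c)%E -> sigma' y = sigma y.
  move=> Gy yc; apply: contrapT => nyE.
  by have := cmin y (conj (or_introl Gy) nyE); rewrite leNgt yc.
have := L_min.2 _ Lc; rewrite le_eqVlt => /predU1P[acE|ac].
  by apply: ncE; rewrite -acE s0 s0'.
apply: ncE; have [[b Gb Sb]|cP] := successor_or_limit Lc ac.
  have GSb : G (S b) by apply: below_succ; rewrite ?Sb.
  by rewrite -Sb sS// sS'// ltcE// -Sb; have [] := succP Gb.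
apply/subr0_eq/normr_lt_eq0 => e e0; have e20 : 0 < e / 2 by lra.
have [b [Gb bc] bP] := sl c cP _ e20; have [b' [Gb' bc'] bP'] := sl' c cP _ e20.
have [r [Gr rc br b'r]] : exists r, [/\ G r%:E, (r%:E < c)%E, b <= r & b' <= r].
  by have [bb'|/ltW b'b] := leP b b'; [exists b'|exists b].
have := bP _ Gr; have := bP' _ Gr; rewrite !lee_fin => /(_ b'r rc) + /(_ br rc).
rewrite ltcE// => P' P.
rewrite -(subrKA (sigma r%:E)) (le_lt_trans (ler_normD _ _))//.
by rewrite (distrC (sigma' c)); lra.
Qed.

(** * Integrable step mappings have summable families *)

Section Step.
Context (z g : \bar R -> E).
Hypothesis g_step : forall b, G b ->
  forall t : R, (b <= t%:E < S b)%E -> g t%:E = z b.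

Lemma summable_of_integrable : HK_integrable_infty a g ->
  exists2 x : \bar R -> E,
    forall b, G b -> is_scaled (S b - b)%E (z b) (x b) & wo_summable G x.
Proof.
move=> [gint [l gl]]; set h := g \o EFin in gint gl.
pose F c := HK_integral a c h.
have gint' c : a <= c -> HK_integrable a c h.
  by rewrite le_eqVlt => /predU1P[<-|/gint//]; exact: HK_integrable_point.
have Fstep r t : G r%:E -> r <= t -> (t%:E <= S r%:E)%E ->
    F t = F r + (t - r) *: z r%:E.
  move=> Gr rt tS; have [_ [<-] ar] := below_fine Gr.
  apply: HK_integral_const_tail => //; first exact: gint'.
    exact/gint'/(le_trans ar).
  move=> s /andP[rs st]; apply: g_step => //; rewrite lee_fin rs/=.
  by apply: lt_le_trans tS; rewrite lte_fin.
have Fl e : 0 < e -> exists M : R, forall t, M < t -> `|F t - l| < e.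
  move=> e0; move/cvgrPdist_lt: gl => /(_ e e0)[M [_ MP]].
  by exists M => t /MP; rewrite distrC.
pose x b := if S b is r%:E then (r - fine b) *: z b else 0.
exists x => [b Gb|].
  (* Only an unbounded block needs an argument: F has slope z b there. *)
  have [_ bS _] := succP Gb; have [r bE _] := below_fine Gb.
  move: bS; rewrite bE /x; case SE : (S r%:E) => [q| |] //= _; split=> //.
  apply: normr_lt_eq0 => e e0; have e20 : 0 < e / 2 by lra.
  have [M MP] := Fl _ e20.
  have [t rt Mt] : exists2 t, r < t & M < t.
    by exists (Num.max r M + 1); rewrite ltr_pwDr// le_max lexx ?orbT.
  rewrite bE in Gb.
  have rt1 : r <= t + 1 by lra.
  have zE : z r%:E = (F (t + 1) - l) - (F t - l).
    rewrite opprB addrA subrK (Fstep r (t + 1)) ?SE ?leey//.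
    rewrite (Fstep r t) ?SE ?leey ?ltW// opprD addrACA subrr add0r -scalerBl.
    have -> : t + 1 - r - (t - r) = 1 by lra.
    by rewrite scale1r.
  rewrite zE (le_lt_trans (ler_normB _ _))//.
  by have := MP t Mt; have := MP (t + 1) (ltr_pwDr ltr01 (ltW Mt)); lra.
pose sigma c := if c is r%:E then F r else l.
suff sigmaP : partial_sums G x sigma.
  by exists sigma => // sigma'; exact: partial_sums_unique.
apply/partial_sumsP; split=> [|b Gb GS|c cP e e0].
- exact: HK_integral_point.
- have [r bE ar] := below_fine Gb; have [q SE _] := below_fine GS.
  rewrite bE in Gb GS SE *; have [_ rq _] := succP Gb.
  rewrite SE lte_fin in rq.
  by rewrite /x SE /= (Fstep r q) ?SE// ltW.
- have approach t : a <= t -> (t%:E < c)%E ->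
      (forall s, t < s -> (s%:E < c)%E -> `|F s - sigma c| < e) ->
      exists2 b0 : R, G b0%:E /\ (b0%:E < c)%E &
        forall b, G b -> (b0%:E <= b)%E -> (b < c)%E ->
          `|sigma b - sigma c| < e.
    move=> a_t tc near_c; have [b0 Gb0 [tb0 b0c]] := limit_approach cP a_t tc.
    exists b0 => // b /below_fine[s -> _]; rewrite lee_fin => b0s sc.
    by apply: near_c => //; exact: lt_le_trans b0s.
  have [Lc ac _] := cP; case: c => [c| |//] in cP Lc ac approach *.
    rewrite lte_fin in ac.
    have hint b : a <= b <= c -> HK_integrable a b h by move=> /andP[/gint'].
    have [d d0 dP] := HK_integral_left_continuous ac hint e0.
    apply: (approach (Num.max a (c - d / 2))).
    + by rewrite le_max lexx.
    + by rewrite lte_fin gt_max ac/=; lra.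
    + move=> s; rewrite gt_max lte_fin => /andP[a_s ds] sc; apply: dP; last lra.
      by rewrite ltW.
  have [M MP] := Fl _ e0; apply: (approach (Num.max a M)).
  + by rewrite le_max lexx.
  + exact: ltry.
  + by move=> s; rewrite gt_max => /andP[_ /MP].
Qed.

(** * Summable families give primitives *)

Section Primitive.
Context (x sigma : \bar R -> E).
Hypothesis xP : forall b, G b -> is_scaled (S b - b)%E (z b) (x b).
Hypothesis sigma0 : sigma a%:E = 0.
Hypothesis sigmaS : forall b, G b -> G (S b) -> sigma (S b) = sigma b + x b.
Hypothesis sigma_limit : forall c, limit_element c -> forall e : R, 0 < e ->
  exists2 b0 : R, G b0%:E /\ (b0%:E < c)%E &
    forall b, G b -> (b0%:E <= b)%E -> (b < c)%E -> `|sigma b - sigma c| < e.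

Definition step_primitive (t : R) : E :=
  sigma (left_end t)%:E + (t - left_end t) *: z (left_end t)%:E.

Lemma step_primitive_end r : G r%:E -> step_primitive r = sigma r%:E.
Proof.
move=> Gr; have [_ rS _] := succP Gr.
by rewrite /step_primitive (left_end_eq Gr)// subrr scale0r addr0.
Qed.

Lemma step_primitive_block r t : G r%:E -> r <= t -> (t%:E < S r%:E)%E ->
  step_primitive t = step_primitive r + (t - r) *: z r%:E.
Proof.
move=> Gr rt tS.
by rewrite (step_primitive_end Gr) /step_primitive (left_end_eq Gr rt).
Qed.

Lemma sum_succ r q : G r%:E -> G q%:E -> S r%:E = q%:E ->
  sigma q%:E = sigma r%:E + (q - r) *: z r%:E.
Proof.
move=> Gr Gq SE; have := xP Gr; rewrite SE -EFinB /= => <-.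
by rewrite -SE sigmaS// SE.
Qed.

Lemma step_primitive_block_closed r q t :
  G r%:E -> S r%:E = q%:E -> r <= t <= q ->
  step_primitive t = step_primitive r + (t - r) *: z r%:E.
Proof.
move=> Gr SE /andP[rt]; rewrite le_eqVlt => /predU1P[->|tq]; last first.
  by apply: step_primitive_block => //; rewrite SE lte_fin.
have Gq : G q%:E by split; [have [] := succP Gr; rewrite SE|exact: ltry].
by rewrite !step_primitive_end//; exact: sum_succ.
Qed.

(** If the sums at both ends of every block in [b0, c) are close to [sigma c],
    then so are the values between them, by convexity of balls; the right end of
    such a block is again below [c] since [c] is not a successor. *)
Lemma step_primitive_limit c : limit_element c -> forall e : R, 0 < e ->
  exists b0 : R, [/\ a <= b0, (b0%:E < c)%E &
    forall t, b0 <= t -> (t%:E < c)%E -> `|step_primitive t - sigma c| < e].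
Proof.
move=> cP e /(sigma_limit cP)[b0 [Gb0 b0c] b0P].
have [_ [<-] ab0] := below_fine Gb0; exists b0; split=> // t b0t tc.
have [Gr rt tS] := left_endP (le_trans ab0 b0t).
set r := left_end t in Gr rt tS.
have b0r : b0 <= r.
  rewrite leNgt; apply/negP => rb0; have [Lb0 _] := Gb0.
  have := lt_le_trans tS (succ_le_left Gr Lb0 _); rewrite !lte_fin => /(_ rb0).
  by rewrite ltNge b0t.
have [Lc _ nS] := cP.
have rc : (r%:E < c)%E by apply: le_lt_trans tc; rewrite lee_fin.
have Sc : (S r%:E < c)%E.
  by rewrite lt_neqAle succ_le_left// andbT; exact/eqP/nS.
have [LS _ _] := succP Gr.
have GS : G (S r%:E) by split=> //; apply: lt_le_trans Sc (leey _).
have [q SE _] := below_fine GS; rewrite SE in GS tS Sc LS.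
rewrite lte_fin in tS.
have sr : `|sigma r%:E - sigma c| < e by apply: b0P; rewrite ?lee_fin.
have sq : `|sigma q%:E - sigma c| < e.
  by apply: b0P; rewrite ?lee_fin// (le_trans b0t)// ltW.
(* k locates t in its block [r, q]. *)
have [k kE] : {k | k = (t - r) / (q - r)} by exists ((t - r) / (q - r)).
have rq : 0 < q - r by lra.
have k0 : 0 <= k by rewrite kE divr_ge0 ?subr_ge0// -subr_ge0 ltW.
have k1 : k < 1 by rewrite kE ltr_pdivrMr// mul1r ltrD2r.
have -> : step_primitive t - sigma c =
    (1 - k) *: (sigma r%:E - sigma c) + k *: (sigma q%:E - sigma c).
  rewrite (step_primitive_block Gr)// ?SE ?lte_fin// step_primitive_end//.
  rewrite (sum_succ Gr GS SE).
  rewrite ![_ + _ - sigma c]addrAC.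
  move: (sigma r%:E - sigma c) => A.
  rewrite scalerDr addrA -scalerDl subrK scale1r.
  by rewrite scalerA kE divfK// gt_eqF.
rewrite (le_lt_trans (ler_normD _ _))//.
have k1' : 0 <= 1 - k by rewrite subr_ge0 ltW.
rewrite !normrZ (ger0_norm k0) (ger0_norm k1').
have lt1 : (1 - k) * `|sigma r%:E - sigma c| < (1 - k) * e.
  by rewrite ltr_pM2l// subr_gt0.
have le2 : k * `|sigma q%:E - sigma c| <= k * e by rewrite ler_wpM2l// ltW.
lra.
Qed.

Lemma step_primitive_left_continuous c : G c%:E -> forall e : R, 0 < e ->
  exists2 d, 0 < d & forall s, a <= s <= c -> c - d < s ->
    `|step_primitive c - step_primitive s| < e.
Proof.
move=> Gc e e0; have [_ [<-] ac] := below_fine Gc.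
have := ac; rewrite le_eqVlt => /predU1P[<-|lt_ac].
  exists 1 => // s /le_anti <- _; by rewrite subrr normr0.
rewrite -lte_fin in lt_ac.
have [[b Gb Sb]|cP] := successor_or_limit Gc.1 lt_ac.
  have [r bE ar] := below_fine Gb; rewrite bE in Gb Sb.
  have [_ rc _] := succP Gb; rewrite Sb lte_fin in rc.
  pose k := `|z r%:E| + 1; have k0 : 0 < k by rewrite ltr_pwDr.
  exists (Num.min (c - r) (e / k)).
    by rewrite lt_min subr_gt0 rc divr_gt0.
  move=> s /andP[a_s sc]; rewrite ltrBlDr -ltrBlDl lt_min => /andP[rs cse].
  have rs' : r <= s by lra.
  rewrite (step_primitive_block_closed Gb Sb (t := c)) ?lexx ?(ltW rc)//.
  rewrite (step_primitive_block_closed Gb Sb (t := s)) ?rs'//.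
  rewrite opprD addrACA subrr add0r -scalerBl.
  have -> : c - r - (s - r) = c - s by lra.
  rewrite normrZ ger0_norm ?subr_ge0//.
  rewrite ltr_pdivlMr// in cse; apply: le_lt_trans cse.
  by rewrite ler_wpM2l ?subr_ge0// /k lerDl.
have [b0 [ab0 b0c b0P]] := step_primitive_limit cP e0; rewrite lte_fin in b0c.
exists (c - b0); first by rewrite subr_gt0.
move=> s /andP[a_s]; rewrite le_eqVlt => /predU1P[->|sc] b0s.
  by rewrite subrr normr0.
by rewrite distrC (step_primitive_end Gc); apply: b0P; [lra|rewrite lte_fin].
Qed.

(** The function [right_end] is the truncated right end of the block of [t].  If
    the tag [s] starts a block and [u < s <= v], then [right_end u <= s], so the
    increment of [right_end] from [u] to [v] is at least the length
    [right_end s - s] of the block of [s]; the error at [s] is made smaller than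
    [eta] times this length. *)
Lemma step_primitive_HK c : a <= c ->
  HK_primitive a c (g \o EFin) step_primitive.
Proof.
move=> ac; apply: HK_primitive_major => e e0.
(* The truncation at c + 1, not c, keeps right_end t > t also for t = c. *)
pose right_end (t : R) : R := fine (mine (S (left_end t)%:E) (c + 1)%:E).
have right_endP t : a <= t <= c -> [/\ t < right_end t, right_end t <= c + 1 &
    ((right_end t)%:E <= S (left_end t)%:E)%E].
  move=> /andP[a_t tc]; rewrite /right_end; have [_ _] := left_endP a_t.
  case: (S (left_end t)%:E) => [q| |]//=; last first.
    by rewrite leey lexx => _; split=> //; lra.
  rewrite lte_fin -EFin_min /= lee_fin lt_min !ge_min !lexx orbT => -> /=.
  by split=> //; lra.
have ca0 : 0 < c + 1 - a by lra.
pose eta := e / 2 / (c + 1 - a).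
have eta0 : 0 < eta by rewrite !divr_gt0.
exists (fun t => eta * right_end t); split.
  have [|ara _ _] := right_endP a; first by rewrite lexx.
  have [|_ crc _] := right_endP c; first by rewrite lexx andbT.
  rewrite -mulrBr (@le_lt_trans _ _ (eta * (c + 1 - a)))//.
    by rewrite ler_pM2l//; lra.
  by rewrite /eta divfK ?gt_eqF//; lra.
move=> s sac; have [srs _ reS] := right_endP s sac; have /andP[a_s sc] := sac.
have [Gr rs sS] := left_endP a_s.
set r := left_end s in reS Gr rs sS *.
have gs : (g \o EFin) s = z r%:E by apply: g_step; rewrite ?lee_fin ?rs.
have same v : r <= v -> v < right_end s -> left_end v = r /\
    step_primitive v = step_primitive r + (v - r) *: z r%:E.
  move=> rv vs; have vS : (v%:E < S r%:E)%E.
    by apply: lt_le_trans reS; rewrite lte_fin.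
  by split; [exact: left_end_eq|exact: step_primitive_block].
have same_block u v : r <= u -> u <= s <= v -> v < right_end s ->
    `|step_primitive v - step_primitive u - (v - u) *: (g \o EFin) s|
      <= eta * right_end v - eta * right_end u.
  move=> ru /andP[us sv] vs.
  have [lv ->] := same v (le_trans rs sv) vs.
  have [lu ->] := same u ru (le_lt_trans us srs).
  rewrite /right_end lv lu subrr gs opprD addrACA subrr add0r -scalerBl.
  have -> : v - r - (u - r) = v - u by lra.
  by rewrite subrr normr0.
move: rs; rewrite le_eqVlt => /predU1P[rs|rs]; last first.
  (* An interior tag: the gauge confines the interval to the block. *)
  exists (Num.min (s - r) (right_end s - s)).
    by rewrite lt_min !subr_gt0 rs.
  move=> u v _ _ suv; rewrite ltrBlDr -!ltrBlDl !lt_min.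
  move=> /andP[ur _] /andP[_ vr]; apply: same_block => //; lra.
pose w := eta * (right_end s - s).
have w0 : 0 < w / 2 by rewrite divr_gt0// mulr_gt0// subr_gt0.
rewrite rs in Gr gs; have [d d0 dP] := step_primitive_left_continuous Gr w0.
pose k := `|z s%:E| + 1; have k0 : 0 < k by rewrite ltr_pwDr.
exists (Num.min (Num.min d (w / 2 / k)) (right_end s - s)).
  by rewrite !lt_min d0 divr_gt0//= subr_gt0.
move=> u v au _ suv; rewrite ltrBlDr -!ltrBlDl !lt_min.
move=> /andP[/andP[sud suk] _] /andP[_ vr].
have {}vr : v < right_end s by lra.
have /andP[us sv] := suv.
move: us; rewrite le_eqVlt => /predU1P[us|us].
  by apply: same_block => //; rewrite rs us.
have [lv pv] : left_end v = r /\
    step_primitive v = step_primitive r + (v - r) *: z r%:E.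
  by apply: same => //; rewrite rs.
have -> : right_end v = right_end s by rewrite /right_end lv.
have reu : right_end u <= s.
  have [|_ _ reu] := right_endP u; first by rewrite au (le_trans (ltW us)).
  rewrite -lee_fin (le_trans reu)//.
  have [Gu lu _] := left_endP au; apply: succ_le_left => //; first by case: Gr.
  by rewrite lte_fin (le_lt_trans lu).
apply: (@le_trans _ _ w); last by rewrite /w -mulrBr ler_pM2l// lerB.
rewrite gs pv rs.
have -> : step_primitive s + (v - s) *: z s%:E - step_primitive u
      - (v - u) *: z s%:E =
    step_primitive s - step_primitive u - (s - u) *: z s%:E.
  have -> : v - u = (v - s) + (s - u) by lra.
  rewrite (scalerDl _ (v - s) (s - u)).
  move: (step_primitive s) (step_primitive u) => fs fu.
  move: ((v - s) *: _) ((s - u) *: _) => p q.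
  by rewrite opprD addrA [fs + p - fu]addrAC addrK.
rewrite (le_trans (ler_normB _ _))//.
have n1 : `|step_primitive s - step_primitive u| < w / 2.
  by apply: dP; [rewrite au ltW|lra].
have n2 : `|(s - u) *: z s%:E| <= w / 2.
  rewrite normrZ gtr0_norm ?subr_gt0//.
  rewrite ltr_pdivlMr// in suk; apply: le_trans (ltW suk).
  by rewrite ler_pM2l ?subr_gt0// /k lerDl.
lra.
Qed.

Lemma step_primitive_cvg : exists l : E,
  HK_integral a c (g \o EFin) @[c --> +oo] --> l.
Proof.
have Fp c : a <= c -> HK_integral a c (g \o EFin) = step_primitive c.
  move=> ac; rewrite (HK_integral_primitive ac (step_primitive_HK ac)).
  by rewrite (step_primitive_end below_min) sigma0 subr0.
have [[b Gb Sb]|ooP] := successor_or_limit L_max (ltry a).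
  have [r bE ar] := below_fine Gb; rewrite bE in Gb Sb.
  have [z0 _] : z r%:E = 0 /\ x r%:E = 0 by have := xP Gb; rewrite Sb.
  exists (sigma r%:E); apply/cvgrPdist_lt => e e0.
  exists r; split; first exact: num_real.
  move=> t rt; rewrite Fp ?(le_trans ar (ltW rt))//.
  rewrite (step_primitive_block Gb (ltW rt)) ?Sb ?ltry// z0 scaler0 addr0.
  by rewrite step_primitive_end// subrr normr0.
exists (sigma +oo%E); apply/cvgrPdist_lt => e e0.
have [b0 [ab0 _ b0P]] := step_primitive_limit ooP e0.
exists b0; split; first exact: num_real.
move=> t b0t; rewrite Fp ?(le_trans ab0 (ltW b0t))// distrC.
by apply: b0P; rewrite ?ltry// ltW.
Qed.
End Primitive.

Lemma integrable_of_summable (x : \bar R -> E) :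
  (forall b, G b -> is_scaled (S b - b)%E (z b) (x b)) ->
  wo_summable G x -> HK_integrable_infty a g.
Proof.
move=> xP [sigma /partial_sumsP[s0 sS sl] _]; split=> [c ac|].
  exists (step_primitive sigma).
  exact: (step_primitive_HK xP sS sl (ltW ac)).
exact: (step_primitive_cvg xP s0 sS sl).
Qed.
End Step.
End Family.
End Blocks.

Theorem proposition3p3 (R : realType) (E : completeNormedModType R) (a : R)
    (L : set (\bar R)) (z g : \bar R -> E)
    (L_wo : well_ordered L)
    (L_sub : L `<=` [set x | (a%:E <= x)%E])
    (L_min : is_min L a%:E)
    (L_max : L +oo%E)
    (L_cover : [set t : R | a <= t] =
       \bigcup_(b in below L +oo%E) [set t : R | (b <= t%:E < succ L b)%E])
    (L_disj : trivIset (below L +oo%E)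
       (fun b => [set t : R | (b <= t%:E < succ L b)%E]))
    (g_step : forall b, below L +oo%E b ->
       forall t : R, (b <= t%:E < succ L b)%E -> g t%:E = z b) :
  HK_integrable_infty a g <->
  exists2 x : \bar R -> E,
    forall b, below L +oo%E b -> is_scaled (succ L b - b)%E (z b) (x b) &
    wo_summable (below L +oo%E) x.
Proof.
split=> [gint|[x xP xsum]].
  exact: (summable_of_integrable L_wo L_min L_max L_cover g_step gint).
exact: (integrable_of_summable L_wo L_min L_max L_cover g_step xP xsum).
Qed.
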